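(* Let $G$ be a $3$-Engel group of exponent $5$. For $x,y\in G$ put \[x+y := xy\,[x,y]^{2}\,[x,y,x]^{3}\,[x,y,y]^{2},\qquad [x,y]_L := [x,y]\,[x,y,x]^{2}\,[x,y,y]^{2},\] where the products, powers and commutators on the right-hand sides are taken in the group $G$. Then $L_G=(G,+,[\cdot,\cdot]_L)$ is a $3$-Engel Lie algebra over $\mathbb{F}_5$ with underlying set $G$. Further, the formula \[x*y := x+y+\tfrac{1}{2}[x,y]_L-\tfrac{1}{12}[x,y,x]_L+\tfrac{1}{12}[x,y,y]_L,\] computed in the Lie algebra $L_G$ (with coefficients read in $\mathbb{F}_5$), defines a group structure on the underlying set of $L_G$ which coincides with the group structure of $G$, i.e. $x*y=x\cdot y$ for all $x,y\in G$.
   Context: Group commutators are $[g,h]=g^{-1}h^{-1}gh$. All commutators and Lie brackets are left-normed: $[x,y,z]=[[x,y],z]$, and likewise $[x,y,z]_L=[[x,y]_L,z]_L$. A group (resp. Lie algebra) is $3$-Engel if $[x,y,y,y]=1$ (resp. $[x,y,y,y]=0$) for all $x,y$. A group has exponent $5$ if $g^5=1$ for every element $g$. *)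

(* Defs.v *)
From HB Require Import structures.
From mathcomp Require Import all_boot all_order all_fingroup all_algebra.

Set Implicit Arguments.
Unset Strict Implicit.
Unset Printing Implicit Defensive.

Import GRing.Theory.

(* [groupType] is the type of arbitrary, possibly infinite, groups; its
   commutator [~ x, y] is x^-1 * (y^-1 * (x * y)) and [~ x, y, z] is
   left-normed. *)
Section Group.
Local Open Scope group_scope.

Definition exponent5_group (G : groupType) : Prop := forall g : G, g ^+ 5 = 1.

Definition engel3_group (G : groupType) : Prop :=
  forall x y : G, [~ x, y, y, y] = 1.

Definition lie_add (G : groupType) (x y : G) : G :=
  x * y * [~ x, y] ^+ 2 * [~ x, y, x] ^+ 3 * [~ x, y, y] ^+ 2.

Definition lie_bracket (G : groupType) (x y : G) : G :=
  [~ x, y] * [~ x, y, x] ^+ 2 * [~ x, y, y] ^+ 2.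

End Group.

Definition is_group_law (T : Type) (op : T -> T -> T) : Prop :=
  associative op /\
  exists2 e : T, left_id e op /\ right_id e op
               & forall x, exists y, op x y = e /\ op y x = e.

Local Open Scope ring_scope.

HB.mixin Record Lmodule_isLieAlgebra (F : fieldType) L of GRing.Lmodule F L := {
  lie : L -> L -> L;
  lieDZl : forall (a : F) (x y z : L),
    lie (a *: x + y) z = a *: lie x z + lie y z;
  lieDZr : forall (a : F) (x y z : L),
    lie z (a *: x + y) = a *: lie z x + lie z y;
  liexx : forall x : L, lie x x = 0;
  lie_jacobi : forall x y z : L,
    lie (lie x y) z + lie (lie y z) x + lie (lie z x) y = 0
}.

#[short(type="lieAlgType")]
HB.structure Definition LieAlgebra (F : fieldType) :=
  { L of Lmodule_isLieAlgebra F L & GRing.Lmodule F L }.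

Notation "[l x1 , x2 , .. , xn ]" := (lie .. (lie x1 x2) .. xn)
  (at level 0, format "[l  x1 ,  x2 ,  .. ,  xn ]") : ring_scope.

(* The type of all F-Lie algebra structures whose underlying set is T. *)
Definition lieAlg_on (F : fieldType) (T : Type) : Type := LieAlgebra.axioms_ F T.

Definition lieAlg_of (F : fieldType) (T : Type) (S : lieAlg_on F T) :
  lieAlgType F := LieAlgebra.Pack S.

Definition engel3_lie (F : fieldType) (L : lieAlgType F) : Prop :=
  forall x y : L, [l x, y, y, y] = 0.

Definition bch (L : lieAlgType 'F_5) (x y : L) : L :=
  x + y + 2^-1 *: [l x, y] - 12^-1 *: [l x, y, x] + 12^-1 *: [l x, y, y].

(* Main.v *)
From HB Require Import structures.
From mathcomp Require Import all_boot all_order all_fingroup all_algebra.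
From mathcomp Require boolp.
Require Import Defs.

(* The Engel identity makes every two-generator subgroup nilpotent of class at
   most 3 and every normal closure N_z nilpotent of class at most 2. Identities in
   two variables are then a matter of collection; the only hard axiom in more
   variables is the associativity of +. Indeed x^(y^k) = x + k [x,y]_L +
   (k^2/2) [x,y,y]_L and conjugation is an automorphism of both operations, so
   comparing coefficients of k gives the bilinearity of [.,.]_L and the Jacobi
   identity.

   For associativity, put A = (x + y) + z and B = x + (y + z). The part of A B^-1
   that is linear in z is computed by Fox calculus in N_z, made into a vector
   space by the Baer sum: it is a noncommutative polynomial in the operators
   "conjugation by x, minus 1" and "conjugation by y, minus 1", words with three
   equal letters vanish, and the polynomial is a combination of linear parts of
   Engel words. Hence A B^-1 is unchanged when z is inverted, and likewise x or y.
   Inverting all three turns A into A^-1 and B into B^-1, so A B^-1 = A^-1 B,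
   which forces A = B as the group has odd exponent. *)

Set Implicit Arguments.
Unset Strict Implicit.
Unset Printing Implicit Defensive.

Import GRing.Theory.
Local Open Scope group_scope.

Ltac group_simpl :=
  rewrite ?(invgM, invgK, invg1, mulgA, mulg1, mul1g, mulgV, mulVg, mulgK,
            mulgVK) //.

(** * Commutators *)

Section GroupIdentities.
Variable G : groupType.
Implicit Types a b c f g x y z : G.

Lemma commgMl x y z : [~ x * y, z] = [~ x, z] ^ y * [~ y, z].
Proof. by rewrite /commg /conjg; group_simpl. Qed.

Lemma commgMr x y z : [~ x, y * z] = [~ x, z] * [~ x, y] ^ z.
Proof. by rewrite /commg /conjg; group_simpl. Qed.

Lemma commgVl x y : [~ x^-1, y] = ([~ x, y] ^ x^-1)^-1.
Proof. by rewrite /commg /conjg; group_simpl. Qed.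

Lemma commgVr x y : [~ x, y^-1] = ([~ x, y] ^ y^-1)^-1.
Proof. by rewrite /commg /conjg; group_simpl. Qed.

Lemma hall_witt x y z :
  [~ x, y^-1, z] ^ y * [~ y, z^-1, x] ^ z * [~ z, x^-1, y] ^ x = 1.
Proof. by rewrite /commg /conjg; group_simpl. Qed.

Lemma commute_conj x y : commute x y -> x ^ y = x.
Proof. by move/commgP/conjg_fixP. Qed.

Lemma conj_commute x y : x ^ y = x -> commute x y.
Proof. by move/conjg_fixP/commgP. Qed.

Lemma commuteJ x y z : commute x y -> commute (x ^ z) (y ^ z).
Proof. by rewrite /commute -!conjMg => ->. Qed.

Lemma commuteJ_iff x y z : commute (x ^ z) (y ^ z) -> commute x y.
Proof. by move/(commuteJ z^-1); rewrite !conjgK. Qed.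

Lemma commuteR c x y : commute c x -> commute c y -> commute c [~ x, y].
Proof. by move=> cx cy; do !apply: commuteM; try apply: commuteV. Qed.

Lemma commute_divl c x y : commute c x -> commute c (x * y) -> commute c y.
Proof.
by move=> cx cxy; rewrite -(mulKg x y); apply: commuteM => //; exact: commuteV.
Qed.

Lemma commute_divr c x y : commute c y -> commute c (x * y) -> commute c x.
Proof.
by move=> cy cxy; rewrite -(mulgK y x); apply: commuteM => //; exact: commuteV.
Qed.

Hypothesis exp5 : exponent5_group G.

Lemma expg_mod5 x n : x ^+ n = x ^+ (n %% 5).
Proof. by rewrite {1}(divn_eq n 5) mulnC expgnDr expgnA exp5 expg1n mul1g. Qed.

Lemma invg_expg4 x : x^-1 = x ^+ 4.
Proof. by apply: mulg1_eq; rewrite -expgS exp5. Qed.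

(** Cubing undoes squaring, as 6 = 1 modulo 5. *)
Lemma sqrg_inj_comm x y : commute x y -> x ^+ 2 = y ^+ 2 -> x = y.
Proof.
move=> xy e; have : (x ^+ 2) ^+ 3 = (y ^+ 2) ^+ 3 by rewrite e.
by rewrite -!expgnA expg_mod5 [RHS]expg_mod5.
Qed.

Lemma sqrg_eq1 x : x ^+ 2 = 1 -> x = 1.
Proof.
by move=> e; apply: sqrg_inj_comm; rewrite ?expg1n //; exact: commute1.
Qed.

Lemma commute_sqr c x : commute c (x ^+ 2) -> commute c x.
Proof. by move/(commuteX 3); rewrite -expgnA expg_mod5. Qed.

End GroupIdentities.

(** * The Engel identity and pairs of conjugates *)

Section Engel.
Variable G : groupType.
Hypotheses (engel : engel3_group G) (exp5 : exponent5_group G).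
Implicit Types a b c f g h u v x y z : G.

(** With v = u^h, the identity [h, u, u, u] = 1 makes u commute with [v^-1, u] = (u^(v^-1))^-1 u,
    hence with u^(v^-1); then conjugate by v. *)
Lemma commute_conj_conj u h : commute u (u ^ (u ^ h)).
Proof.
have e : [~ h, u] = (u ^ h)^-1 * u by rewrite /commg /conjg; group_simpl.
have := engel h u; rewrite e (commgMl (u ^ h)^-1) commgg mulg1 => /eqP/commgP.
rewrite -[X in commute _ X](commute_conj (commute_refl u)) => /commuteJ_iff.
move: (u ^ h) => v cu {e h}.
have {}cu : commute (u ^ v^-1) u.
  have -> : u ^ v^-1 = ([~ v^-1, u] * u^-1)^-1.
    by rewrite /commg /conjg; group_simpl.
  apply: commute_sym; apply: commuteV; apply: commuteM; first exact: commute_sym.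
  exact: commuteV.
by have := commuteJ v cu; rewrite conjgKV.
Qed.

Lemma commute_commg_conj u h : commute [~ u, u ^ h] u.
Proof.
rewrite commgEl; apply: commute_sym; apply: commuteM; first exact: commuteV.
exact: commute_conj_conj.
Qed.

(** This is [commute_commg_conj] for the pair (u^h, u). Together they say that u and u^h generate a
    subgroup of class at most 2. *)
Lemma commute_conj_commg u h : commute [~ u, u ^ h] (u ^ h).
Proof.
apply: commute_sym; rewrite -invgR; apply: commuteV; apply: commute_sym.
by have := commute_commg_conj (u ^ h) h^-1; rewrite conjgK.
Qed.
End Engel.

(** * Two-generator subgroups and normal closures *)

Section TwoGenerators.
Variable G : groupType.
Hypotheses (engel : engel3_group G) (exp5 : exponent5_group G).
Implicit Types a b c f g h u v x y z : G.

(* With x_i the conjugate of x by g^i, the Engel identity for x and for x^-1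
   expresses x_3 through x_0, x_1, x_2 in two ways. *)
Lemma conj_braid x g (x1 := x ^ g) (x2 := x1 ^ g) :
  x * x1^-1 * x2 = x2 * x1^-1 * x.
Proof.
have key y (y1 := y ^ g) (y2 := y1 ^ g) (y3 := y2 ^ g) :
    y1^-1 * y * y1^-1 * y2 = y2^-1 * y1 * y2^-1 * y3.
  have := engel y g; have -> : [~ y, g, g] = y1^-1 * y * y1^-1 * y2.
    by rewrite /y2 /y1 /commg /conjg; group_simpl.
  move/eqP/commgP/commute_conj => /esym.
  by rewrite 3!conjMg !conjVg.
have := key x; have := key x^-1; rewrite /= !conjVg !invgK -/x1 -/x2.
set x3 := x2 ^ g => e1 e2; clearbody x3 x2 x1.
have {}e1 : x3 = x2 * x1^-1 * x * x1^-1 * x2 * x1^-1 * x2.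
  apply: invg_inj; rewrite -(mulKg (x2 * x1^-1 * x2) x3^-1).
  by rewrite -e1; group_simpl.
have {}e2 : x3 = x2 * x1^-1 * x2 * x1^-1 * x * x1^-1 * x2.
  by rewrite -(mulKg (x2^-1 * x1 * x2^-1) x3) -e2; group_simpl.
move: e1; rewrite {}e2 -!mulgA => /mulgI/mulgI; rewrite !mulgA => /mulIg/mulIg.
by move=> ->.
Qed.

(** Move x1^-1 to the front on both sides of [conj_braid] and compare the commutators that arise;
    [x1, x] and [x2, x] commute with x. *)
Lemma commg_conj_shift x g (x1 := x ^ g) (x2 := x1 ^ g) :
  [~ x2, x] = [~ x2, x1] * [~ x1, x] ^ x2.
Proof.
have e0 : [~ x, x1^-1] = [~ x1, x].
  by rewrite commgVr commute_conj ?invgR //; exact/commuteV/commute_conj_commg.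
have e1 : [~ x2, x1^-1] = [~ x2, x1]^-1.
  rewrite commgVr commute_conj // -(invgR x1 x2).
  by apply/commuteV/commute_sym/commuteV/commute_sym; exact: commute_commg_conj.
have xd : commute x [~ x2, x].
  rewrite -invgR; apply/commuteV/commute_sym.
  by rewrite /x2 /x1 -conjgM; exact: commute_commg_conj.
have xc : commute x [~ x1, x].
  by rewrite -invgR; apply/commuteV/commute_sym; exact: commute_commg_conj.
have f0 := commgC x x1^-1; have f1 := commgC x2 x1^-1; have f2 := commgC x x2.
have := conj_braid x g; rewrite /= -/x1 -/x2.
rewrite e0 in f0; rewrite e1 in f1; rewrite -(invgR x2 x) in f2.
clearbody x2 x1; clear e0 e1;
move: [~ x1, x] [~ x2, x1] [~ x2, x] f0 f1 f2 xd xc.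
move=> c0 c1 d f0 f1 f2 xd xc e.
suff : c0 * x2 = x2 * c1^-1 * d by rewrite conjgE => ->; group_simpl.
move: e; rewrite f0 f1 -!mulgA => /mulgI.
rewrite !mulgA xc -(mulgA _ x) f2 -!mulgA (commuteV xd) !mulgA => /mulIg <-.
by rewrite mulgVK.
Qed.

(** Replacing x by x^-1 keeps the three commutators of [commg_conj_shift] but turns conjugation by
    x2 into conjugation by x2^-1. So x2^2 centralises [x1, x], and then so does x2. *)
Lemma commute_commg_conj2 x g (x1 := x ^ g) (x2 := x1 ^ g) :
  commute [~ x1, x] x2.
Proof.
apply: (commute_sqr exp5); apply: conj_commute.
have := commg_conj_shift x g; have := commg_conj_shift x^-1 g => /=.
have inv u h : [~ (u ^ h)^-1, u^-1] = [~ u ^ h, u].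
  have ca : commute [~ u ^ h, u] u.
    rewrite -invgR; apply/commute_sym/commuteV/commute_sym.
    exact: commute_commg_conj.
  have cb : commute [~ u ^ h, u] (u ^ h).
    rewrite -invgR; apply/commute_sym/commuteV/commute_sym.
    exact: commute_conj_commg.
  rewrite commgVl commgVr (commute_conj (commuteV ca)) conjVg invgK.
  exact/commute_conj/commuteV.
have i02 : [~ x2^-1, x^-1] = [~ x2, x] by rewrite /x2 /x1 -conjgM inv.
rewrite !conjVg -/x1 -/x2 (inv x g) (inv x1 g) i02 => -> /mulgI e.
by rewrite expg2 conjgM -e conjgKV.
Qed.

(* The Engel identity for (x, x * g) makes conjugation by g fix [x^g, x]. *)
Lemma commute_commg_conj_actor x g : commute [~ x ^ g, x] g.
Proof.
pose x1 := x ^ g; pose x2 := x1 ^ g; pose c0 := [~ x1, x]; pose c1 := [~ x2, x1].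
have c01 : c0 ^ g = c1 by rewrite conjRg.
have c0x : commute c0 x.
  rewrite /c0 -invgR; apply/commute_sym/commuteV/commute_sym.
  exact: commute_commg_conj.
have c0x1 : commute c0 x1.
  rewrite /c0 -invgR; apply/commute_sym/commuteV/commute_sym.
  exact: commute_conj_commg.
have c0x2 : commute c0 x2 by exact: commute_commg_conj2.
have c1x1 : commute c1 x1 by rewrite -c01; exact: commuteJ.
have d : [~ x2, x] = c1 * c0.
  by rewrite commg_conj_shift -/x1 -/x2 -/c0 -/c1 (commute_conj c0x2).
have c0c1 : commute c0 c1 by exact: commuteR.
have c1x : commute c1 x.
  apply: commute_sym; apply: (commute_divr (y := c0)); first exact: commute_sym.
  rewrite -d -invgR; apply/commuteV/commute_sym.
  by rewrite /x2 /x1 -conjgM; exact: commute_commg_conj.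
pose u := x1^-1 * x * x1^-1 * x2.
have uE : [~ x, g, g] = u by rewrite /u /x2 /x1 /commg /conjg; group_simpl.
have ug : commute u g by rewrite -uE; apply/commgP; rewrite engel.
have wE : [~ x, x * g, x * g] = u * c1.
  have -> : [~ x, x * g] = x^-1 * x1 by rewrite /x1 /commg /conjg; group_simpl.
  rewrite commgEl conjgM (conjMg x^-1 x1 x) conjVg (commute_conj (commute_refl x)).
  have -> : x1 ^ x = x1 * c0 by rewrite /c0 /commg /conjg; group_simpl.
  rewrite (conjMg x^-1) (conjMg x1) conjVg c01 -/x1 -/x2 /u.
  by clearbody x1 x2 c1; group_simpl.
have wc : commute (u * c1) (x * g) by rewrite -wE; apply/commgP; rewrite engel.
have e : u ^ x * c1 = u * c0.
  apply: (@conjg_inj _ g); rewrite [RHS]conjMg (commute_conj ug) c01.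
  rewrite -[RHS](commute_conj wc) (conjgM _ x g).
  by rewrite (conjMg u c1 x) (commute_conj c1x).
(* Computed factor by factor, this conjugate turns [e] into c1^2 = c0^2, whence c0^g = c0. *)
have ux : u ^ x = u * c0^-1 * c1.
  rewrite /u 3!conjMg conjVg (commute_conj (commute_refl x)).
  have -> : x1 ^ x = x1 * c0 by rewrite /c0 commgEl mulVKg.
  have -> : x2 ^ x = x2 * c0 * c1 by rewrite -mulgA c0c1 -d commgEl mulVKg.
  have cV y w : commute c0 y -> c0^-1 * (y * w) = y * (c0^-1 * w).
    move=> cy; rewrite !mulgA; congr (_ * w).
    exact/commute_sym/commuteV/commute_sym.
  move: (cV _ ^~ (commuteV c0x1)) (cV _ ^~ c0x) (cV _ ^~ c0x2).
  clearbody x1 x2 c0 c1; rewrite invgM -!mulgA => e1 e0 e2.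
  by rewrite !(e1, e0, e2) mulKg.
have c01E : c0 = c1.
  apply: (sqrg_inj_comm exp5) => //.
  move: e; rewrite ux -2!(mulgA u) => /mulgI; clear -G.
  by move: c0 c1 => c0 c1 e; rewrite !expg2 -{2}e -mulgA mulVKg.
by apply: conj_commute; rewrite c01.
Qed.
End TwoGenerators.

(** * Normal closures have class at most 2 *)

Definition conjugate (G : groupType) (x y : G) : Prop := exists g, y = x ^ g.

Section NormalClosure.
Variable G : groupType.
Hypotheses (engel : engel3_group G) (exp5 : exponent5_group G).
Implicit Types a b c f g h u v x y z : G.

Lemma conjugate_sym x y : conjugate x y -> conjugate y x.
Proof. by case=> g ->; exists g^-1; rewrite conjgK. Qed.

Lemma conjugate_trans x y z : conjugate x y -> conjugate y z -> conjugate x z.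
Proof. by case=> g -> [h ->]; exists (g * h); rewrite conjgM. Qed.

Lemma conjugateJ x y g : conjugate x y -> conjugate x (y ^ g).
Proof. by case=> h ->; exists (h * g); rewrite conjgM. Qed.

Lemma commute_conjugate a b : conjugate a b -> commute a (a ^ b).
Proof. by case=> g ->; exact: commute_conj_conj. Qed.

(* If c centralises x then x^(c*g) = x^g, so [x^g, x] commutes with both g and
   c*g. *)
Lemma commute_commg_centl a b c :
  conjugate a b -> commute a c -> commute [~ a, b] c.
Proof.
case=> g -> ac; rewrite -invgR; apply/commute_sym/commuteV/commute_sym.
apply: (commute_divr (y := g)); first exact: commute_commg_conj_actor.
have e : a ^ g = a ^ (c * g) by rewrite conjgM (commute_conj ac).
by rewrite e; exact: commute_commg_conj_actor.
Qed.

Lemma commute_commg_centr a b c :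
  conjugate a b -> commute b c -> commute [~ a, b] c.
Proof.
move=> /conjugate_sym ba bc; rewrite -invgR.
apply/commute_sym/commuteV/commute_sym; exact: commute_commg_centl.
Qed.

Lemma commute_conjugateR a b : conjugate a b -> commute a [~ a, b].
Proof.
move=> ab; rewrite commgEl; apply: commuteM; first exact: commuteV.
exact: commute_conjugate.
Qed.

(** Here a^b = a [a, b], and [a, x] commutes with [a, b] because a does. This exhibits [a, b, x] as
    a quotient of commutators of two conjugates, whose centralisers are known. *)
Lemma commg_conjM a b x :
  conjugate a b -> conjugate a x -> [~ a ^ b, x] = [~ a, x] * [~ a, b, x].
Proof.
move=> ab ax; have -> : a ^ b = a * [~ a, b] by rewrite commgEl mulVKg.
rewrite commgMl commute_conj //; apply: commute_commg_centl => //.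
exact: commute_conjugateR.
Qed.

Section Triple.
Variables a b x : G.
Hypotheses (ab : conjugate a b) (ax : conjugate a x).

Lemma commute_commg3_cent c : commute x c -> commute [~ a, b, x] c.
Proof.
move=> xc; have e := commg_conjM ab ax.
apply: commute_sym; apply: (commute_divl (x := [~ a, x])).
  exact/commute_sym/commute_commg_centr.
rewrite -e; apply/commute_sym/commute_commg_centr => //.
by apply/conjugate_sym/conjugateJ/conjugate_sym.
Qed.

Lemma commute_commg3_1 : commute [~ a, b, x] a.
Proof.
have e := commg_conjM ab ax.
apply: commute_sym; apply: (commute_divl (x := [~ a, x])).
  exact: commute_conjugateR.
rewrite -e; apply/commute_sym/commute_commg_centl.
  by apply/conjugate_sym/conjugateJ/conjugate_sym.
exact/commute_sym/commute_conjugate.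
Qed.

End Triple.

(** As [b, a] = [a, b]^-1, it suffices that [a, b, x] commute with a and b. For b, conjugate the
    corresponding fact on [b, a, x] by [a, b], which fixes b. *)
Lemma commg3_anti a b x : conjugate a b -> conjugate a x ->
  [~ b, a, x] = [~ a, b, x]^-1.
Proof.
move=> ab ax; have ba := conjugate_sym ab; have bx := conjugate_trans ba ax.
have e : [~ b, a, x] = ([~ a, b, x] ^ [~ a, b]^-1)^-1.
  by rewrite -(invgR a b) commgVl.
have qb : commute [~ a, b, x] b.
  have -> : [~ a, b, x] = [~ b, a, x]^-1 ^ [~ a, b] by rewrite e invgK conjgKV.
  have eb : b ^ [~ a, b] = b.
    rewrite commute_conj // -invgR; exact/commuteV/commute_conjugateR.
  rewrite -[X in commute _ X]eb; apply/commuteJ/commute_sym/commuteV/commute_sym.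
  exact: commute_commg3_1.
rewrite e commute_conj //; apply: commuteV; apply: commuteR => //.
exact: commute_commg3_1.
Qed.

Lemma commute_commg3_2 a b x : conjugate a b -> conjugate a x ->
  commute [~ a, b, x] b.
Proof.
move=> ab ax; have ba := conjugate_sym ab; have bx := conjugate_trans ba ax.
rewrite commg3_anti //; apply/commute_sym/commuteV/commute_sym.
exact: commute_commg3_1.
Qed.

(** In the Hall-Witt identity each factor is the inverse of a triple commutator, by [key]. *)
Lemma commg3_jacobi a b x : conjugate a b -> conjugate a x ->
  [~ x, b, a] = [~ a, b, x] * [~ x, a, b].
Proof.
move=> ab ax; have ba := conjugate_sym ab; have bx := conjugate_trans ba ax.
have xa := conjugate_sym ax; have xb := conjugate_sym bx.
have key u v w : conjugate u v -> conjugate u w ->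
    [~ u, v^-1, w] ^ v = [~ u, v, w]^-1.
  move=> uv uw; have vu := conjugate_sym uv; have vw := conjugate_trans vu uw.
  have e : [~ u, v^-1] = [~ v, u].
    rewrite commgVr commute_conj ?invgR // -invgR; apply/commuteV.
    by apply/commute_sym/commuteV/commute_conjugateR.
  by rewrite e -commg3_anti // commute_conj //; exact: commute_commg3_1.
have := hall_witt a b x; rewrite !key // => h.
rewrite (commg3_anti bx ba).
move: h; move: [~ a, b, x] [~ b, x, a] [~ x, a, b] => q r p h.
by apply: (mulIg p^-1); apply: (mulgI q^-1); rewrite mulgA h mulgK mulVg.
Qed.

(* Since [x^(g*b), x] = [a, x][a, b, x] is centralised by g*b and [a, x] by g,
   conjugation by g permutes the three commutators. *)
Lemma commg3_conj x g b (a := x ^ g) : conjugate a b ->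
  [~ a, b, x] ^ g = [~ x, b, a].
Proof.
move=> ab; have ax : conjugate a x by apply: conjugate_sym; exists g.
have xa := conjugate_sym ax; have xb := conjugate_trans xa ab.
rewrite (commg3_jacobi ab ax); set q := [~ a, b, x]; set p := [~ a, x].
have pg : p ^ g = p by exact/commute_conj/commute_commg_conj_actor.
have pqgb : (p * q) ^ (g * b) = p * q.
  rewrite -commg_conjM // /a -conjgM.
  exact/commute_conj/commute_commg_conj_actor.
have qb : q ^ b = q by exact/commute_conj/commute_commg3_2.
have pb : p ^ b = p * [~ p, b] by rewrite commgEl mulVKg.
have pbb : [~ p, b] ^ b = [~ p, b].
  exact/commute_conj/commute_commg3_cent/commute_refl.
have e : q = [~ p, b] * q ^ g.
  apply: (@conjg_inj _ b); rewrite qb (conjMg [~ p, b] (q ^ g) b) pbb.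
  apply: (mulgI p); rewrite -pqgb conjgM (conjMg p q g) pg (conjMg p (q ^ g) b).
  by rewrite pb; exact/esym/mulgA.
have xab : [~ x, a, b] = [~ p, b]^-1 by rewrite -commg3_anti.
have qpb : commute q [~ p, b].
  have qa : commute q a by exact: commute_commg3_1.
  have qb' : commute q b by exact: commute_commg3_2.
  have qx : commute q x by exact/commute_commg3_cent.
  by apply: commuteR => //; exact: commuteR.
rewrite xab (commuteV qpb).
by rewrite -[RHS]/([~ p, b]^-1 * q) {2}e mulKg.
Qed.

(* The three elements of {x, x^g, x^h} play symmetric roles; going around the
   triangle with g, h and g^-1 * h yields [x, a, b] = [x, a, b]^-1. *)
Theorem commg3_conjugate a b x :
  conjugate x a -> conjugate x b -> [~ a, b, x] = 1.
Proof.
case=> g -> [h ->].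
have xg : conjugate x (x ^ g) by exists g.
have xh : conjugate x (x ^ h) by exists h.
have gx := conjugate_sym xg; have hx := conjugate_sym xh.
have gh := conjugate_trans gx xh; have hg := conjugate_sym gh.
have e1 := commg3_conj gh; have e2 := commg3_conj hg.
have agb : (x ^ g) ^ (g^-1 * h) = x ^ h by rewrite conjgM conjgK.
have e3 : [~ x ^ h, x, x ^ g] ^ (g^-1 * h) = [~ x ^ g, x, x ^ h].
  by have := @commg3_conj (x ^ g) (g^-1 * h) x; rewrite agb; exact.
have {}e2 : [~ x, x ^ g, x ^ h] = ([~ x ^ g, x ^ h, x] ^ h)^-1.
  by rewrite -e2 commg3_anti // conjVg.
have p2 : [~ x, x ^ g, x ^ h] ^+ 2 = 1.
  rewrite expg2 {1}e2 -[X in _ * X]invgK -(commg3_anti xg xh) -e3.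
  rewrite (commg3_anti xh xg).
  by rewrite -e1 conjVg invgK -conjgM mulVKg mulVg.
move/(sqrg_eq1 exp5): p2; rewrite e2 => /eqP; rewrite invg_eq1 conjg_eq1.
by move/eqP.
Qed.

Inductive nclosure z : G -> Prop :=
  | nclosure1 : nclosure z 1
  | nclosureM u v : nclosure z u -> nclosure z v -> nclosure z (u * v)
  | nclosureV u : nclosure z u -> nclosure z u^-1
  | nclosure_gen g : nclosure z (z ^ g).

Lemma nclosure_id z : nclosure z z.
Proof. by rewrite -[X in nclosure _ X]conjg1; exact: nclosure_gen. Qed.

Lemma nclosureJ z u g : nclosure z u -> nclosure z (u ^ g).
Proof.
elim=> [|v w _ iv _ iw|v _ iv|h]; first by rewrite conj1g; exact: nclosure1.
- by rewrite conjMg; exact: nclosureM.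
- by rewrite conjVg; exact: nclosureV.
- by rewrite -conjgM; exact: nclosure_gen.
Qed.

Lemma nclosureR z u v : nclosure z u -> nclosure z [~ u, v].
Proof.
move=> zu; rewrite commgEl.
by apply: nclosureM; [exact: nclosureV|exact: nclosureJ].
Qed.

Lemma commute_nclosure z w c :
  (forall g, commute c (z ^ g)) -> nclosure z w -> commute c w.
Proof.
move=> cz; elim=> //; first exact: commute1.
  by move=> *; exact: commuteM.
by move=> *; exact: commuteV.
Qed.

(** A centraliser in G rather than the centre of N_z: [layer] tests elements of one normal closure
    against another. *)
Definition nclosure_cent z c := forall w, nclosure z w -> commute c w.

Lemma nclosure_cent1 z : nclosure_cent z 1.
Proof. by move=> w _; apply/commute_sym/commute1. Qed.

Lemma nclosure_centM z c d :
  nclosure_cent z c -> nclosure_cent z d -> nclosure_cent z (c * d).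
Proof.
by move=> zc zd w zw; apply/commute_sym/commuteM; apply/commute_sym; auto.
Qed.

Lemma nclosure_centV z c : nclosure_cent z c -> nclosure_cent z c^-1.
Proof. by move=> zc w zw; apply/commute_sym/commuteV/commute_sym; auto. Qed.

Lemma nclosure_centJ z c g : nclosure_cent z c -> nclosure_cent z (c ^ g).
Proof.
move=> zc w zw; apply: (@commuteJ_iff _ _ _ g^-1); rewrite conjgK.
exact/zc/nclosureJ.
Qed.

(** Induction on u and v reduces to conjugates of z, where [commg3_conjugate] applies with the third
    conjugate as base point. *)
Theorem nclosure_class2 z u v :
  nclosure z u -> nclosure z v -> nclosure_cent z [~ u, v].
Proof.
have gens g h : nclosure_cent z [~ z ^ g, z ^ h].
  move=> w; apply: commute_nclosure => k; apply/commgP/eqP/commg3_conjugate.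
    by exists (k^-1 * g); rewrite conjgM conjgK.
  by exists (k^-1 * h); rewrite conjgM conjgK.
have gen g x : nclosure z x -> nclosure_cent z [~ z ^ g, x].
  elim=> {x} [|x y _ ix _ iy|x _ ix|h] //.
  - by rewrite commg1; exact: nclosure_cent1.
  - by rewrite commgMr; apply: nclosure_centM => //; exact: nclosure_centJ.
  - by rewrite commgVr; apply/nclosure_centV/nclosure_centJ.
move=> zu zv; elim: zu => {u} [|x y _ ix _ iy|x _ ix|g].
- by rewrite comm1g; exact: nclosure_cent1.
- by rewrite commgMl; apply: nclosure_centM => //; exact: nclosure_centJ.
- by rewrite commgVl; apply/nclosure_centV/nclosure_centJ.
- exact: gen.
Qed.

End NormalClosure.

(** * Collection in two generators *)

Inductive word := WX | WY | WMul of word & word | WInv of word | WExp of word & nat.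

Definition WComm u v := WMul (WInv u) (WMul (WInv v) (WMul u v)).
Definition WAdd u v := WMul (WMul (WMul (WMul u v)
  (WExp (WComm u v) 2)) (WExp (WComm (WComm u v) u) 3))
  (WExp (WComm (WComm u v) v) 2).
Definition WBracket u v := WMul (WMul (WComm u v)
  (WExp (WComm (WComm u v) u) 2)) (WExp (WComm (WComm u v) v) 2).
Definition WConj u v := WMul (WInv v) (WMul u v).

Fixpoint word_eval (G : groupType) (x y : G) w : G :=
  match w with
  | WX => x
  | WY => y
  | WMul u v => word_eval x y u * word_eval x y v
  | WInv u => (word_eval x y u)^-1
  | WExp u n => word_eval x y u ^+ n
  end.

(* (i, j, k, l, m) stands for x^i y^j [x,y]^k [x,y,x]^l [x,y,y]^m; in the product
   with x below, 4 is -1 modulo 5. *)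
Definition normal := (nat * nat * nat * nat * nat)%type.

Definition normal_mulx (t : normal) : normal :=
  let '(i, j, k, l, m) := t in
  (i.+1 %% 5, j, (k + 4 * j) %% 5, (l + k) %% 5, (m + 4 * 'C(j, 2)) %% 5)%N.

Definition normal_muly (t : normal) : normal :=
  let '(i, j, k, l, m) := t in (i, j.+1 %% 5, k, l, (m + k) %% 5)%N.

Definition normal_mul (t s : normal) : normal :=
  let '(i', j', k', l', m') := s in
  let '(i, j, k, l, m) := iter j' normal_muly (iter i' normal_mulx t) in
  (i, j, (k + k') %% 5, (l + l') %% 5, (m + m') %% 5)%N.

Definition normal_exp (t : normal) n : normal :=
  iter n (normal_mul^~ t) (0, 0, 0, 0, 0)%N.

Fixpoint word_normal w : normal :=
  match w with
  | WX => (1, 0, 0, 0, 0)%N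
  | WY => (0, 1, 0, 0, 0)%N
  | WMul u v => normal_mul (word_normal u) (word_normal v)
  | WInv u => normal_exp (word_normal u) 4
  | WExp u n => normal_exp (word_normal u) (n %% 5)
  end.

Definition normal_val (G : groupType) (x y c d e : G) (t : normal) : G :=
  let '(i, j, k, l, m) := t in x ^+ i * y ^+ j * c ^+ k * d ^+ l * e ^+ m.

Section Collection.
Variable G : groupType.
Hypothesis exp5 : exponent5_group G.
Variables x y c d e : G.
Hypotheses (yx : y * x = x * (y * c^-1)) (cx : c ^ x = c * d) (cy : c ^ y = c * e).
Hypotheses (dx : commute d x) (dy : commute d y) (dc : commute d c).
Hypotheses (ex : commute e x) (ey : commute e y) (ec : commute e c).
Hypothesis de : commute d e.

Local Notation val := (normal_val x y c d e).

Let c_x k : c ^+ k * x = x * (c ^+ k * d ^+ k).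
Proof.
rewrite -expgMn; last exact: commute_sym.
by rewrite (conjgC (c ^+ k)) conjXg cx.
Qed.

Let c_y k j : c ^+ k * y ^+ j = y ^+ j * (c ^+ k * e ^+ (k * j)).
Proof.
elim: j => [|j IHj]; first by rewrite muln0 !expg0 !mulg1 mul1g.
rewrite expgSr mulgA IHj mulnS expgnDr -!mulgA.
rewrite -(commuteX (k * j) (commute_sym ey)) (mulgA (c ^+ k)).
rewrite (conjgC (c ^+ k) y) conjXg cy expgMn; last exact: commute_sym.
by rewrite -!mulgA.
Qed.

(** Each y crossed by x leaves a c^-1, which then crosses the y's to its right and leaves an e^-1 at
    each, C(j, 2) in all. *)
Let y_x j : y ^+ j * x = x * (y ^+ j * c ^+ (4 * j) * e ^+ (4 * 'C(j, 2))).
Proof.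
elim: j => [|j IHj]; first by rewrite !expg0 !mulg1 mul1g.
rewrite expgS -mulgA IHj mulgA yx invg_expg4 //.
have := c_y 4 j; have := expgnDr c 4 (4 * j); rewrite -mulnS; move: (c ^+ 4).
move=> c4 c4j c4y; rewrite -!mulgA; congr (_ * (_ * _)).
rewrite (mulgA c4) c4y -!mulgA c4j; congr (_ * _); rewrite -!mulgA; congr (_ * _).
have -> : (4 * 'C(j.+1, 2) = 4 * j + 4 * 'C(j, 2))%N.
  by rewrite binS bin1 mulnDr addnC.
move: (4 * j)%N (4 * 'C(j, 2))%N => p q; rewrite expgnDr !mulgA; congr (_ * _).
exact: commuteX2.
Qed.

Let ed m l w : e ^+ m * (d ^+ l * w) = d ^+ l * (e ^+ m * w).
Proof. by rewrite !mulgA (commuteX2 m l (commute_sym de)). Qed.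

Let eK m k w : e ^+ m * (c ^+ k * w) = c ^+ k * (e ^+ m * w).
Proof. by rewrite !mulgA (commuteX2 m k ec). Qed.

Let dK l k w : d ^+ l * (c ^+ k * w) = c ^+ k * (d ^+ l * w).
Proof. by rewrite !mulgA (commuteX2 l k dc). Qed.

Lemma normal_mulxP t : val t * x = val (normal_mulx t).
Proof.
case: t => [] [] [] [] i j k l m; rewrite /normal_val /normal_mulx.
rewrite -!(expg_mod5 exp5).
have xe : e ^+ m * x = x * e ^+ m by exact/commute_sym/commuteX/commute_sym.
have xd w : d ^+ l * (x * w) = x * (d ^+ l * w).
  by rewrite !mulgA (commuteX l (commute_sym dx)).
have xc w : c ^+ k * (x * w) = x * (c ^+ k * (d ^+ k * w)).
  by rewrite !mulgA c_x !mulgA.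
have := y_x j; move: (4 * j)%N (4 * 'C(j, 2))%N => p q jx.
have xy w : y ^+ j * (x * w) = x * (y ^+ j * (c ^+ p * (e ^+ q * w))).
  by rewrite !mulgA jx !mulgA.
rewrite (addnC k) (expgnDr c) (addnC l) (expgnDr d) (addnC m) (expgnDr e) expgSr.
by rewrite -!mulgA xe xd xc xy eK !ed.
Qed.

Lemma normal_mulyP t : val t * y = val (normal_muly t).
Proof.
case: t => [] [] [] [] i j k l m; rewrite /normal_val /normal_muly.
rewrite -!(expg_mod5 exp5).
have ye : e ^+ m * y = y * e ^+ m by exact/commute_sym/commuteX/commute_sym.
have yd w : d ^+ l * (y * w) = y * (d ^+ l * w).
  by rewrite !mulgA (commuteX l (commute_sym dy)).
have yc w : c ^+ k * (y * w) = y * (c ^+ k * (e ^+ k * w)).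
  by have := c_y k 1; rewrite expg1 muln1 => cky; rewrite mulgA cky -!mulgA.
rewrite (addnC m) (expgnDr e) expgSr.
by rewrite -!mulgA ye yd yc !ed.
Qed.

Lemma normal_mulP t s : val t * val s = val (normal_mul t s).
Proof.
case: s => [] [] [] [] i' j' k' l' m'; rewrite {2}/normal_val /normal_mul.
have ix n : val t * x ^+ n = val (iter n normal_mulx t).
  by elim: n => [|n IHn] /=; rewrite ?mulg1 // -normal_mulxP -IHn expgSr mulgA.
have iy n u : val u * y ^+ n = val (iter n normal_muly u).
  by elim: n => [|n IHn] /=; rewrite ?mulg1 // -normal_mulyP -IHn expgSr mulgA.
rewrite !mulgA ix iy; case: (iter j' _ _) => [] [] [] [] i j k l m.
rewrite /normal_val -!(expg_mod5 exp5) (expgnDr c) (expgnDr d) (expgnDr e).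
by rewrite -!mulgA !eK !dK ed.
Qed.

Lemma normal_expP t n : val t ^+ n = val (normal_exp t n).
Proof.
elim: n => [|n IHn] /=; first by rewrite !mulg1.
by rewrite expgSr IHn normal_mulP.
Qed.

Lemma word_normalP w : word_eval x y w = val (word_normal w).
Proof.
elim: w => [||u IHu v IHv|u IHu|u IHu n] /=.
- by rewrite !mulg1.
- by rewrite !mulg1 mul1g.
- by rewrite IHu IHv normal_mulP.
- by rewrite IHu invg_expg4 // normal_expP.
- by rewrite IHu expg_mod5 // normal_expP.
Qed.

End Collection.

(** * Two-variable identities of the Lie operations *)

Section TwoGeneratorIdentities.
Variable G : groupType.
Hypotheses (engel : engel3_group G) (exp5 : exponent5_group G).
Implicit Types u v x y : G.

(** Since u^v = u [u, v], the commutator [u, v, u] equals [u^v, u], which commutes with u and, by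
    [commute_commg_conj_actor], with v. *)
Lemma commg3_commute u v : commute [~ u, v, u] u /\ commute [~ u, v, u] v.
Proof.
have -> : [~ u, v, u] = [~ u ^ v, u].
  have -> : u ^ v = u * [~ u, v] by rewrite commgEl mulVKg.
  by rewrite (commgMl u) commgg conj1g mul1g.
split; last exact: commute_commg_conj_actor.
rewrite -invgR; apply/commute_sym/commuteV/commute_sym.
exact: commute_commg_conj.
Qed.

Lemma commg3_commute2 x y : commute [~ x, y, y] x /\ commute [~ x, y, y] y.
Proof.
have [sy sx] := commg3_commute y x; set s := [~ y, x, y] in sy sx.
set c := [~ x, y]; set e := [~ x, y, y].
have eE : e = s^-1 ^ c.
  by rewrite /s -(invgR x y) (commgVl [~ x, y]) invgK -conjgM mulVg conjg1.
have sc : commute s c by exact: commuteR.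
have {}eE : e = s^-1.
  by rewrite eE commute_conj //; apply/commute_sym/commuteV/commute_sym.
by rewrite eE; split; apply/commute_sym/commuteV/commute_sym.
Qed.

(* Two elements generate a subgroup of class at most 3, so identities in two
   variables are decided by collection. *)
Lemma two_generator_eq x y w1 w2 :
  word_normal w1 = word_normal w2 -> word_eval x y w1 = word_eval x y w2.
Proof.
have [dx dy] := commg3_commute x y; have [ex ey] := commg3_commute2 x y.
have yx : y * x = x * (y * [~ x, y]^-1) by rewrite (commgC y x) -(invgR x y) mulgA.
have cz z : [~ x, y] ^ z = [~ x, y] * [~ x, y, z] by rewrite commgEl mulVKg.
have dc := commuteR dx dy; have ec := commuteR ex ey; have de := commuteR dc dy.
by move=> e12; rewrite !(word_normalP exp5 yx (cz x) (cz y)) ?e12.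
Qed.

Lemma lie_addC x y : lie_add x y = lie_add y x.
Proof. exact: (@two_generator_eq x y (WAdd WX WY) (WAdd WY WX)). Qed.

Lemma lie_addV x y : (lie_add x y)^-1 = lie_add x^-1 y^-1.
Proof.
exact: (@two_generator_eq x y (WInv (WAdd WX WY)) (WAdd (WInv WX) (WInv WY))).
Qed.

Lemma lie_bracketC x y : lie_bracket x y = (lie_bracket y x)^-1.
Proof.
exact: (@two_generator_eq x y (WBracket WX WY) (WInv (WBracket WY WX))).
Qed.

Lemma lie_bracket_engel x y :
  lie_bracket (lie_bracket (lie_bracket x y) y) y = 1.
Proof.
apply: (@two_generator_eq x y
          (WBracket (WBracket (WBracket WX WY) WY) WY) (WExp WX 0)).
by vm_compute.
Qed.

(* x^(y^k) = x + k [x, y]_L + (k^2 / 2) [x, y, y]_L, with 1/2 = 3 modulo 5. *)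
Lemma conj_lie_add x y k : k < 5 ->
  x ^ (y ^+ k) = lie_add (lie_add x (lie_bracket x y ^+ k))
                         (lie_bracket (lie_bracket x y) y ^+ (3 * k ^ 2)).
Proof.
move=> k5; apply: (@two_generator_eq x y (WConj WX (WExp WY k))
  (WAdd (WAdd WX (WExp (WBracket WX WY) k))
        (WExp (WBracket (WBracket WX WY) WY) (3 * k ^ 2)))).
by do 5!case: k k5 => [|k] k5 //; vm_compute.
Qed.

(* Modulo 5, 1/2 = 1/12 = 3 and -1/12 = 2. *)
Lemma mulg_bch x y :
  x * y = lie_add (lie_add (lie_add (lie_add x y) (lie_bracket x y ^+ 3))
                   (lie_bracket (lie_bracket x y) x ^+ 2))
            (lie_bracket (lie_bracket x y) y ^+ 3).
Proof.
apply: (@two_generator_eq x y (WMul WX WY)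
  (WAdd (WAdd (WAdd (WAdd WX WY) (WExp (WBracket WX WY) 3))
        (WExp (WBracket (WBracket WX WY) WX) 2))
        (WExp (WBracket (WBracket WX WY) WY) 3))).
by vm_compute.
Qed.

Lemma lie_add_commute x y : commute x y -> lie_add x y = x * y.
Proof.
by move/commgP/eqP => e; rewrite /lie_add e !comm1g !expg1n !mulg1.
Qed.

Lemma lie_addJ x y g : lie_add x y ^ g = lie_add (x ^ g) (y ^ g).
Proof. by rewrite /lie_add 4!conjMg !conjXg !conjRg. Qed.

Lemma lie_bracketJ x y g : lie_bracket x y ^ g = lie_bracket (x ^ g) (y ^ g).
Proof. by rewrite /lie_bracket 2!conjMg !conjXg !conjRg. Qed.

End TwoGeneratorIdentities.

(** * The Baer sum on a group of class 2 *)

Definition class2 (M : groupType) : Prop := forall u v w : M, commute [~ u, v] w.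

(* As -1/2 = 2 modulo 5, this is the Baer sum u v [u,v]^(-1/2). *)
Definition baer_add (M : groupType) (u v : M) : M := u * v * [~ u, v] ^+ 2.

(** An alias of M indexed by the two proofs, so that the additive instances can depend on them. *)
Definition baer (M : groupType) (M2 : class2 M)
  (M5 : exponent5_group M) : Type := M.

Section Baer.
Variable M : groupType.
Hypotheses (M2 : class2 M) (M5 : exponent5_group M).
Implicit Types u v w : M.

Lemma class2_commgMl u v w : [~ u * v, w] = [~ u, w] * [~ v, w].
Proof. by rewrite commgMl (commute_conj (M2 _ _ _)). Qed.

Lemma class2_commgVl u v : [~ u^-1, v] = [~ u, v]^-1.
Proof. by rewrite commgVl (commute_conj (M2 _ _ _)). Qed.

Lemma class2_commgVr u v : [~ u, v^-1] = [~ u, v]^-1.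
Proof. by rewrite commgVr (commute_conj (M2 _ _ _)). Qed.

Lemma class2_commg_center c u : (forall v, commute c v) -> [~ c, u] = 1.
Proof. by move=> cc; apply/eqP/commgP. Qed.

Let c2 u v w : commute ([~ u, v] ^+ 2) w.
Proof. exact/commute_sym/commuteX/commute_sym/M2. Qed.

Lemma baer_addC u v : baer_add u v = baer_add v u.
Proof.
rewrite /baer_add -(invgR u v) (commgC u v); move: [~ u, v] => c.
rewrite -(mulgA (v * u)); congr (_ * _); rewrite -expgS expVgn.
by apply: (mulIg (c ^+ 2)); rewrite mulVg -expgnDr; exact: M5.
Qed.

Lemma baer_commgl u v w : [~ baer_add u v, w] = [~ u, w] * [~ v, w].
Proof.
rewrite (class2_commgMl (u * v)) (class2_commgMl u).
by rewrite (class2_commg_center _ (c2 u v)) mulg1.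
Qed.

Lemma baer_commgr u v w : [~ w, baer_add u v] = [~ w, u] * [~ w, v].
Proof. by rewrite -invgR baer_commgl invgM !invgR M2. Qed.

Lemma baer_addA : associative (@baer_add M).
Proof.
move=> u v w; rewrite {1 3}/baer_add baer_commgl baer_commgr /baer_add.
rewrite !(expgMn _ (M2 _ _ _)).
move: (c2 u v) (c2 u w) (c2 v w).
move: ([~ u, v] ^+ 2) ([~ u, w] ^+ 2) ([~ v, w] ^+ 2) => p q r cp cq cr.
rewrite -!mulgA; congr (_ * (_ * _)).
rewrite (mulgA p w) (cp w) -!mulgA; congr (_ * _).
by rewrite (mulgA r p) (cr p) -mulgA (cr q).
Qed.

Lemma baer_add1 : left_id 1 (@baer_add M).
Proof. by move=> u; rewrite /baer_add comm1g expg1n mul1g mulg1. Qed.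

Lemma baer_addV : left_inverse 1 (fun u => u^-1) (@baer_add M).
Proof.
by move=> u; rewrite /baer_add mulVg -(invgR u) commgVg invg1 expg1n mulg1.
Qed.

HB.instance Definition _ := Choice.on (baer M2 M5).
HB.instance Definition _ := GRing.isZmodule.Build (baer M2 M5)
  baer_addA baer_addC baer_add1 baer_addV.

Local Notation V := (baer M2 M5).

Lemma baer_addE (u v : V) : (u + v)%R = baer_add (u : M) (v : M). Proof. by []. Qed.
Lemma baer_oppE (u : V) : (- u)%R = (u : M)^-1. Proof. by []. Qed.

Lemma baer_mulrn (u : V) n : (u *+ n)%R = (u : M) ^+ n.
Proof.
elim: n => // n IHn; rewrite mulrS IHn expgS baer_addE /baer_add.
by rewrite commgXg expg1n mulg1.
Qed.

Lemma baer_mulr5 (u : V) : (u *+ 5 = 0)%R.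
Proof. by rewrite baer_mulrn M5. Qed.

End Baer.

(** * Noncommutative polynomials over the integers modulo 5 *)

(* The letter true acts as fa and false as fb. *)
Definition poly2 := seq (nat * seq bool).

Fixpoint poly2_ins c w (p : poly2) : poly2 :=
  if p is (d, v) :: q then
    if w == v then (((c + d) %% 5)%N, v) :: q else (d, v) :: poly2_ins c w q
  else [:: ((c %% 5)%N, w)].

(** Words with three equal letters, adjacent or not; [word_act_dead_diffV] shows that they act as
    0. *)
Definition dead_word (w : seq bool) := (2 < count id w) || (2 < count negb w).

Fixpoint poly2_norm (p : poly2) : poly2 :=
  if p is (c, w) :: q then
    if dead_word w then poly2_norm q else poly2_ins c w (poly2_norm q)
  else [::].

Definition poly2_add (p q : poly2) := poly2_norm (p ++ q).
Definition poly2_scale c (p : poly2) : poly2 := [seq (c * t.1, t.2)%N | t <- p].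
(** The left factor acts first, which matches conjugation as a right action. *)
Definition poly2_mul (p q : poly2) : poly2 :=
  poly2_norm [seq (t.1 * s.1, t.2 ++ s.2)%N | t <- p, s <- q].
Definition poly2_null (p : poly2) := all (fun t => t.1 == 0) (poly2_norm p).

Section PolyAction.
Local Open Scope ring_scope.
Variables (V : zmodType) (fa fb : V -> V).
Hypotheses (faD : {morph fa : u v / u + v}) (fbD : {morph fb : u v / u + v}).
Hypothesis V5 : forall u : V, u *+ 5 = 0.

Definition word_act (u : V) (w : seq bool) : V :=
  foldl (fun v b => if b : bool then fa v else fb v) u w.

Hypothesis word_act_dead : forall u w, dead_word w -> word_act u w = 0.

Definition poly2_act (p : poly2) (u : V) : V :=
  \sum_(t <- p) word_act u t.2 *+ t.1.

Lemma mulrn_mod5 (u : V) n : u *+ n = u *+ (n %% 5).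
Proof. by rewrite {1}(divn_eq n 5) mulrnDr mulnC mulrnA V5 mul0rn add0r. Qed.

Lemma word_actD w : {morph word_act^~ w : u v / u + v}.
Proof.
by elim: w => //= b w IHw u v; case: b; rewrite ?faD ?fbD IHw.
Qed.

Lemma word_act0 w : word_act 0 w = 0.
Proof. by apply: (addrI (word_act 0 w)); rewrite -word_actD !addr0. Qed.

Lemma poly2_act_nil u : poly2_act [::] u = 0. Proof. exact: big_nil. Qed.

Lemma poly2_act_cons t p u :
  poly2_act (t :: p) u = word_act u t.2 *+ t.1 + poly2_act p u.
Proof. exact: big_cons. Qed.

Lemma poly2_act_cat p q u :
  poly2_act (p ++ q) u = poly2_act p u + poly2_act q u.
Proof. exact: big_cat. Qed.

Lemma poly2_act_ins c w p u :
  poly2_act (poly2_ins c w p) u = word_act u w *+ c + poly2_act p u.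
Proof.
elim: p => [|[d v] p IHp] /=; first by rewrite poly2_act_cons /= -mulrn_mod5.
case: eqP => [->|_]; rewrite !poly2_act_cons /=; last by rewrite IHp addrCA.
by rewrite -mulrn_mod5 mulrnDr addrA.
Qed.

Lemma poly2_act_norm p u : poly2_act (poly2_norm p) u = poly2_act p u.
Proof.
elim: p => //= [[c w] p] IHp; rewrite poly2_act_cons /=.
case: ifP => [/word_act_dead->|_]; first by rewrite mul0rn add0r.
by rewrite poly2_act_ins IHp.
Qed.

Lemma poly2_actDr p : {morph poly2_act p : u v / u + v}.
Proof.
move=> u v; rewrite -big_split; apply: eq_bigr => t _.
by rewrite word_actD mulrnDl.
Qed.

Lemma poly2_act0 p : poly2_act p 0 = 0.
Proof. by rewrite /poly2_act big1 // => t _; rewrite word_act0 mul0rn. Qed.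

Lemma poly2_actMn p u n : poly2_act p (u *+ n) = poly2_act p u *+ n.
Proof.
by elim: n => [|n IHn]; rewrite ?poly2_act0 // !mulrS poly2_actDr IHn.
Qed.

Lemma poly2_act_add p q u :
  poly2_act (poly2_add p q) u = poly2_act p u + poly2_act q u.
Proof. by rewrite poly2_act_norm poly2_act_cat. Qed.

Lemma poly2_act_scale c p u :
  poly2_act (poly2_scale c p) u = poly2_act p u *+ c.
Proof.
rewrite /poly2_act big_map -sumrMnl; apply: eq_bigr => t _ /=.
by rewrite mulnC mulrnA.
Qed.

Lemma poly2_act_mul p q u :
  poly2_act (poly2_mul p q) u = poly2_act q (poly2_act p u).
Proof.
rewrite poly2_act_norm; elim: p => [|t p IHp].
  by rewrite !poly2_act_nil poly2_act0.
rewrite /= poly2_act_cat IHp poly2_act_cons poly2_actDr; congr (_ + _).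
rewrite poly2_actMn /poly2_act big_map -sumrMnl; apply: eq_bigr => s _ /=.
by rewrite /word_act foldl_cat -/(word_act _ _) -!mulrnA mulnC.
Qed.

Lemma poly2_act_null p u : poly2_null p -> poly2_act p u = 0.
Proof.
rewrite -poly2_act_norm /poly2_null; elim: (poly2_norm p) => [|t q IHq] /=.
  by rewrite poly2_act_nil.
by case/andP=> /eqP t0 /IHq q0; rewrite poly2_act_cons t0 mulr0n add0r.
Qed.

End PolyAction.

(** * Linear parts of words over a normal closure *)

(** [asbool] makes membership boolean, as a subtype requires; the result is a group in its own
    right, to which the Baer sum applies. *)
Definition nclosure_group (G : groupType) (z : G) : Type :=
  {u : G | boolp.asbool (nclosure z u)}.

Section NClosureGroup.
Variables (G : groupType) (z : G).

Lemma nclosure_group_closed :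
  group_closed (fun u : G => boolp.asbool (nclosure z u)).
Proof.
split=> [|u v]; first exact/boolp.asboolP/nclosure1.
move=> /boolp.asboolP zu /boolp.asboolP zv.
by apply/boolp.asboolP; apply: nclosureM => //; exact: nclosureV.
Qed.

HB.instance Definition _ := SubChoice.on (nclosure_group z).
HB.instance Definition _ := SubChoice_isSubGroup.Build G _ (nclosure_group z)
  nclosure_group_closed.

Lemma nclosure_val (u : nclosure_group z) : nclosure z (val u).
Proof. exact/boolp.asboolP/(valP u). Qed.

Lemma val_nclosureM (u v : nclosure_group z) : val (u * v) = val u * val v.
Proof. exact: gmulfM. Qed.

Lemma val_nclosure1 : val (1 : nclosure_group z) = 1.
Proof. exact: gmulf1. Qed.

Lemma val_nclosureV (u : nclosure_group z) : val u^-1 = (val u)^-1.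
Proof. exact: gmulfV. Qed.

Definition nclosure_elt u (zu : nclosure z u) : nclosure_group z :=
  Sub u (introT (boolp.asboolP _) zu).

Lemma val_nclosure_elt u (zu : nclosure z u) : val (nclosure_elt zu) = u.
Proof. exact: SubK. Qed.

Definition nclosure_conj (g : G) (u : nclosure_group z) : nclosure_group z :=
  nclosure_elt (nclosureJ g (nclosure_val u)).

Lemma val_nclosure_conj g u : val (nclosure_conj g u) = val u ^ g.
Proof. exact: val_nclosure_elt. Qed.

Lemma nclosure_conjM g : {morph nclosure_conj g : u v / u * v}.
Proof. by move=> u v; apply: val_inj; rewrite /= conjMg. Qed.

End NClosureGroup.

(* For a word e(n) in x, y and n: lin_fwd and lin_bwd give the action of e(1)
   and of its inverse, lin_part is the part of e(n) of degree 1 in n (a Fox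
   derivative), all as polynomials in the operators diffV x and diffV y. *)
Record linear_word := LinearWord
  { lin_fwd : poly2; lin_bwd : poly2; lin_part : poly2 }.

(** The Fox product rule: bringing the linear part of t to the left of s(1) conjugates it by
    s(1)^-1. *)
Definition lin_mul s t := LinearWord
  (poly2_mul (lin_fwd s) (lin_fwd t)) (poly2_mul (lin_bwd t) (lin_bwd s))
  (poly2_add (lin_part s) (poly2_mul (lin_part t) (lin_bwd s))).
Definition lin_inv s := LinearWord (lin_bwd s) (lin_fwd s)
  (poly2_mul (poly2_scale 4 (lin_part s)) (lin_fwd s)).
Definition lin_one := LinearWord [:: (1%N, [::])] [:: (1%N, [::])] [::].
Definition lin_exp s n := iter n (lin_mul s) lin_one.
Definition lin_comm s t := lin_mul (lin_inv s) (lin_mul (lin_inv t) (lin_mul s t)).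
Definition lin_add s t :=
  let c := lin_comm s t in
  lin_mul (lin_mul (lin_mul (lin_mul s t) (lin_exp c 2)) (lin_exp (lin_comm c s) 3))
    (lin_exp (lin_comm c t) 2).
Definition lin_engel s t := lin_comm (lin_comm (lin_comm s t) t) t.

(** With X = [diffV x] and X^3 = 0, the inverse of 1 + X is 1 - X + X^2; 4 stands for -1. *)
Definition lin_x := LinearWord [:: (1%N, [::]); (1%N, [:: true])]
  [:: (1%N, [::]); (4%N, [:: true]); (1%N, [:: true; true])] [::].
Definition lin_y := LinearWord [:: (1%N, [::]); (1%N, [:: false])]
  [:: (1%N, [::]); (4%N, [:: false]); (1%N, [:: false; false])] [::].
Definition lin_n := LinearWord [:: (1%N, [::])] [:: (1%N, [::])] [:: (1%N, [::])].

Section Linear.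
Variables (G : groupType) (engel : engel3_group G) (exp5 : exponent5_group G).
Variable z : G.
Local Notation M := (nclosure_group z).

Lemma nclosure_group_class2 : class2 M.
Proof.
move=> u v w; apply: val_inj; rewrite [LHS]gmulfM [RHS]gmulfM gmulfR.
by apply: (nclosure_class2 engel exp5); exact: nclosure_val.
Qed.

Lemma nclosure_group_exp5 : exponent5_group M.
Proof. by move=> u; apply: val_inj; rewrite gmulfXn exp5 gmulf1. Qed.

Definition nclosure_module := baer nclosure_group_class2 nclosure_group_exp5.
HB.instance Definition _ := GRing.Zmodule.on nclosure_module.
Local Notation V := nclosure_module.

Lemma val_addV (u v : V) :
  val (u + v : V)%R = val (u : M) * val (v : M) * [~ val (u : M), val (v : M)] ^+ 2.
Proof.
have e : (u + v)%R = (u : M) * (v : M) * [~ (u : M), (v : M)] ^+ 2 :> M by [].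
by rewrite e gmulfM (gmulfM (u : M) (v : M)) gmulfXn gmulfR.
Qed.

Lemma val_oppV (u : V) : val (- u : V)%R = (val (u : M))^-1.
Proof. exact: gmulfV. Qed.

Definition conjV (g : G) (u : V) : V := nclosure_conj g u.

Lemma val_conjV g (u : V) : val (conjV g u : M) = val (u : M) ^ g.
Proof. exact: val_nclosure_conj. Qed.

Lemma conjVD g : {morph conjV g : u v / (u + v)%R}.
Proof.
move=> u v; apply: val_inj; rewrite val_conjV !val_addV !val_conjV.
by rewrite 2!conjMg conjXg conjRg.
Qed.

Lemma conjVM g h u : conjV (g * h) u = conjV h (conjV g u).
Proof. by apply: val_inj; rewrite !val_conjV conjgM. Qed.

Lemma conjV1 u : conjV 1 u = u.
Proof. by apply: val_inj; rewrite !val_conjV conjg1. Qed.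

Lemma conjVN g u : conjV g (- u)%R = (- conjV g u)%R.
Proof. by apply: val_inj; rewrite val_conjV !val_oppV val_conjV conjVg. Qed.

Definition diffV g (u : V) : V := (conjV g u - u)%R.

Lemma diffVD g : {morph diffV g : u v / (u + v)%R}.
Proof. by move=> u v; rewrite /diffV conjVD opprD addrACA. Qed.

(** Stages through which [diffV x] drives V to 0 in three steps. Every other [diffV g] preserves
    each stage, so letters in between do no harm. *)
Definition layer (x : G) i (u : V) : Prop :=
  match i with
  | 0 => True
  | 1 => nclosure x (val (u : M))
  | 2 => nclosure_cent x (val (u : M))
  | _ => u = 0%R
  end.

Lemma layerB x i u v : layer x i u -> layer x i v -> layer x i (u - v)%R.
Proof.
case: i => [|[|[|i]]] //; rewrite /layer ?val_addV ?val_oppV.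
- move=> zu zv; apply: nclosureM.
    by apply: nclosureM => //; exact: nclosureV.
  by rewrite expg2; apply: nclosureM; exact: nclosureR.
- move=> zu zv; have zv' := nclosure_centV zv.
  have zc : nclosure_cent x [~ val u, (val v)^-1].
    rewrite commgEl; apply: nclosure_centM; first exact: nclosure_centV.
    exact: nclosure_centJ.
  exact: nclosure_centM (nclosure_centM zu zv') (nclosure_centM zc zc).
- by move=> -> ->; rewrite subrr.
Qed.

Lemma layer_conjV x i g u : layer x i u -> layer x i (conjV g u).
Proof.
case: i => [|[|[|i]]] //; rewrite /layer ?val_conjV.
- exact: nclosureJ.
- exact: nclosure_centJ.
- move=> ->; have /esym/eqP := conjVD g 0%R 0%R.
  by rewrite addr0 -subr_eq0 addrK => /eqP.
Qed.

Lemma layer_diffV x i g u : layer x i u -> layer x i (diffV g u).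
Proof. by move=> xu; apply: layerB => //; exact: layer_conjV. Qed.

(** Up to a commutator, [diffV x] sends m to m^x m^-1 = x^-1 x^(m^-1) = [x, m^-1]. This lies in N_x;
    it centralises N_x if m is in N_x, by class 2; and x fixes m if m centralises N_x. *)
Lemma layer_diffV_incr x i u : layer x i u -> layer x i.+1 (diffV x u).
Proof.
have val_diff : val (diffV x u : M) = val u ^ x * (val u)^-1 *
    [~ val u ^ x, (val u)^-1] ^+ 2 by rewrite val_addV val_oppV val_conjV.
case: i => [|[|[|i]]] //; rewrite /layer.
- move=> _; rewrite val_diff; set m := val u.
  have zk : nclosure x (m ^ x * m^-1).
    have -> : m ^ x * m^-1 = x^-1 * x ^ m^-1 by rewrite /conjg; group_simpl.
    by apply: nclosureM; [apply/nclosureV/nclosure_id|exact: nclosure_gen].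
  have -> : [~ m ^ x, m^-1] = [~ m ^ x * m^-1, m^-1] ^ m.
    rewrite -[in LHS](mulgVK m (m ^ x)).
    by rewrite (commgMl (m ^ x * m^-1) m) commgVg mulg1.
  rewrite expg2; do 2!apply: nclosureM => //;
    by apply/nclosureJ/nclosureR.
- move=> zu; rewrite val_diff; set m := val u in zu *.
  have -> : m ^ x * m^-1 = [~ x, m^-1] by rewrite /commg /conjg; group_simpl.
  have zm := nclosureV zu; rewrite expg2.
  have zx := nclosure_id x; have zmx := nclosureJ x zu.
  have c2 := nclosure_class2 engel exp5.
  have c' := c2 _ _ _ zmx zm.
  exact: nclosure_centM (c2 _ _ _ zx zm) (nclosure_centM c' c').
- move=> zu; apply/eqP; rewrite subr_eq0; apply/eqP; apply: val_inj.
  by rewrite val_conjV commute_conj //; apply: zu; exact: nclosure_id.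
- by move=> ->; rewrite /diffV (@layer_conjV x 3 x 0%R) ?subrr.
Qed.

Section TwoOperators.
Variables x y : G.

Lemma word_act_dead_diffV u w :
  dead_word w -> word_act (diffV x) (diffV y) u w = 0%R.
Proof.
have layer3 g i v : 2 < i -> layer g i v -> v = 0%R by case: i => [|[|[|]]].
have lx i v s : layer x i v ->
    layer x (i + count id s) (word_act (diffV x) (diffV y) v s).
  elim: s i v => [|b s IHs] i v /= xv; first by rewrite addn0.
  case: b; rewrite ?add1n ?add0n ?addnS -?addSn; apply: IHs.
    exact: layer_diffV_incr.
  exact: layer_diffV.
have ly i v s : layer y i v ->
    layer y (i + count negb s) (word_act (diffV x) (diffV y) v s).
  elim: s i v => [|b s IHs] i v /= xv; first by rewrite addn0.
  case: b; rewrite ?add1n ?add0n ?addnS -?addSn; apply: IHs.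
    exact: layer_diffV.
  exact: layer_diffV_incr.
case/orP=> c2.
- exact: layer3 c2 (@lx 0 u w I).
- exact: layer3 c2 (@ly 0 u w I).
Qed.

Local Notation act := (poly2_act (diffV x) (diffV y)).

Lemma mulr5V (u : V) : (u *+ 5 = 0)%R. Proof. exact: baer_mulr5. Qed.

Let actM := poly2_act_mul (diffVD x) (diffVD y) mulr5V word_act_dead_diffV.
Let actD := poly2_act_add mulr5V word_act_dead_diffV.

Lemma mulr4V (u : V) : (u *+ 4)%R = (- u)%R.
Proof. by apply/eqP; rewrite -addr_eq0 -mulrSr mulr5V. Qed.

Lemma baer_mul (u v : V) :
  (u : M) * (v : M) = ((u + v)%R : M) * [~ (u : M), (v : M)] ^- 2.
Proof. by rewrite baer_addE /baer_add mulgK. Qed.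

Variable m : V.

(* g = e(m), g' = e(m^-1) and g0 = e(1): the even part of e is central. *)
Definition linearises (g g' g0 : G) (t : linear_word) : Prop :=
  [/\ exists2 q : M, forall u, commute q u &
        g = val (act (lin_part t) m : M) * val q * g0 /\
        g' = (val (act (lin_part t) m : M))^-1 * val q * g0,
      forall u, conjV g0 u = act (lin_fwd t) u
    & forall u, conjV g0^-1 u = act (lin_bwd t) u].

(** Linear parts add up in the Baer sum. The correction [l, k']^-2 is unchanged when l and k' are
    both inverted, so it joins the central even part. *)
Lemma linearises_mul g g' g0 s h h' h0 t :
  linearises g g' g0 s -> linearises h h' h0 t ->
  linearises (g * h) (g' * h') (g0 * h0) (lin_mul s t).
Proof.
case=> [[q qc [-> ->]] sf sb] [[r rc [-> ->]] tf tb]; split; last 2 first.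
- by move=> u; rewrite conjVM sf tf actM.
- by move=> u; rewrite invgM conjVM sb tb actM.
set l := act (lin_part s) m; set k := act (lin_part t) m.
have lkE : act (lin_part (lin_mul s t)) m = (l + conjV g0^-1 k)%R.
  by rewrite actD actM sb.
set k' : M := nclosure_conj g0^-1 k; set r' : M := nclosure_conj g0^-1 r.
have rc' u : commute r' u.
  have -> : u = nclosure_conj g0^-1 (nclosure_conj g0 u).
    by apply: val_inj; rewrite !val_nclosure_conj conjgK.
  by rewrite /commute -!nclosure_conjM rc.
exists ([~ l : M, k'] ^- 2 * q * r').
  move=> u; apply: commute_sym; do 2?apply: commuteM => //.
  - apply/commuteV/commuteX/commute_sym; exact: nclosure_group_class2.
  - exact: commute_sym.
  - exact: commute_sym.
rewrite lkE.
have e1 : l * q * (k' * r') =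
    ((l + (k' : V))%R : M) * ([~ l : M, k'] ^- 2 * q * r').
  have := baer_mul l k'; move: ((l + (k' : V))%R : M) ([~ l : M, k'] ^- 2) => p c e.
  by rewrite !mulgA -e -(mulgA (l : M)) qc !mulgA.
have e2 : (l : M)^-1 * q * (k'^-1 * r') =
    ((l + (k' : V))%R : M)^-1 * ([~ l : M, k'] ^- 2 * q * r').
  have := baer_mul (- l)%R (- (k' : V))%R; rewrite -opprD !baer_oppE.
  have M2 := nclosure_group_class2.
  rewrite (class2_commgVl M2) (class2_commgVr M2) invgK.
  move: ((l + (k' : V))%R : M) ([~ l : M, k'] ^- 2) => p c e.
  by rewrite !mulgA -e -(mulgA (l : M)^-1) qc !mulgA.
have val_k u : g0 * val u = val (nclosure_conj g0^-1 u) * g0.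
  by rewrite val_nclosure_conj /conjg; group_simpl.
have eM (u v w : M) : val u * val v * g0 * (val w * val r * h0) =
    val (u * v * (nclosure_conj g0^-1 w * r')) * (g0 * h0).
  rewrite !val_nclosureM -!mulgA; do 2!congr (_ * _).
  by rewrite (mulgA g0) val_k -!mulgA (mulgA g0) val_k -!mulgA.
have kV : nclosure_conj g0^-1 (k : M)^-1 = k'^-1.
  apply: val_inj; rewrite /k' val_nclosure_conj !val_nclosureV.
  by rewrite val_nclosure_conj conjVg.
split; first by rewrite eM e1 val_nclosureM.
by rewrite -!val_nclosureV eM kV e2 val_nclosureM.
Qed.

Lemma linearises_inv g g' g0 s :
  linearises g g' g0 s -> linearises g^-1 g'^-1 g0^-1 (lin_inv s).
Proof.
case=> [[q qc [-> ->]] sf sb]; split=> [||u]; last 2 first.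
- exact: sb.
- by rewrite invgK.
set l := act (lin_part s) m.
have lE : act (lin_part (lin_inv s)) m = (- conjV g0 l)%R.
  by rewrite actM -sf poly2_act_scale mulr4V -/l conjVN.
exists (nclosure_conj g0 q^-1).
  move=> u; have -> : u = nclosure_conj g0 (nclosure_conj g0^-1 u).
    by apply: val_inj; rewrite !val_nclosure_conj conjgKV.
  rewrite /commute -!nclosure_conjM; congr nclosure_conj.
  exact/commute_sym/commuteV/commute_sym.
rewrite lE val_oppV val_conjV invgK val_nclosure_conj val_nclosureV.
have ql : commute (val q) (val (l : M)) by rewrite /commute -!val_nclosureM qc.
move: (val (l : M)) (val q) ql => u v uv; rewrite /conjg; split.
  by rewrite (_ : u * v = v * u) //; group_simpl.
have e : v^-1 * u = u * v^-1 by apply: commute_sym; exact/commuteV/commute_sym.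
by group_simpl; rewrite -(mulgA _ v^-1) e; group_simpl.
Qed.

Lemma val_zeroV : val (0%R : V) = 1 :> G. Proof. exact: val_nclosure1. Qed.

Lemma word_act_nil u : act [:: (1%N, [::])] u = u.
Proof. by rewrite poly2_act_cons poly2_act_nil addr0. Qed.

Lemma linearises_free g t : lin_part t = [::] ->
  (forall u, conjV g u = act (lin_fwd t) u) ->
  (forall u, conjV g^-1 u = act (lin_bwd t) u) -> linearises g g g t.
Proof.
move=> t0 tf tb; split=> //.
exists 1; first by move=> u; exact/commute_sym/commute1.
by rewrite t0 poly2_act_nil val_zeroV invg1 ?val_nclosure1 !mul1g.
Qed.

Lemma linearises_one : linearises 1 1 1 lin_one.
Proof. by apply: linearises_free => // u; rewrite ?invg1 conjV1 word_act_nil. Qed.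

Lemma conjV_diff g u : conjV g u = (u + diffV g u)%R.
Proof. by rewrite /diffV addrC subrK. Qed.

(* The cube of diffV g vanishes, hence the inverse of 1 + diffV g. *)
Lemma conjV_inv_diff g u :
  conjV g^-1 u = (u - diffV g u + diffV g (diffV g u))%R.
Proof.
set d := diffV g.
have d3 : d (d (d u)) = 0%R.
  have l3 : layer g 3 (d (d (d u))) by do 3!apply: layer_diffV_incr.
  exact: l3.
have dD : {morph d : v w / (v + w)%R} := diffVD g.
have dN v : d (- v)%R = (- d v)%R by rewrite /d /diffV conjVN opprD.
have e : conjV g (u - d u + d (d u))%R = u.
  rewrite conjV_diff -/d; clearbody d; rewrite !dD dN d3 addr0 addrACA subrr addr0.
  by rewrite addrNK.
by rewrite -{1}e -conjVM mulgV conjV1.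
Qed.

Lemma linearises_x : linearises x x x lin_x.
Proof.
apply: linearises_free => // u; rewrite !poly2_act_cons poly2_act_nil /=.
  by rewrite addr0 conjV_diff.
by rewrite addr0 mulr4V addrA conjV_inv_diff.
Qed.

Lemma linearises_y : linearises y y y lin_y.
Proof.
apply: linearises_free => // u; rewrite !poly2_act_cons poly2_act_nil /=.
  by rewrite addr0 conjV_diff.
by rewrite addr0 mulr4V addrA conjV_inv_diff.
Qed.

Lemma linearises_n : linearises (val (m : M)) (val (m : M))^-1 1 lin_n.
Proof.
split=> [|u|u]; rewrite ?invg1 ?conjV1 ?word_act_nil //.
exists 1; first by move=> u; exact/commute_sym/commute1.
by rewrite val_nclosure1 !mulg1.
Qed.

Lemma linearises_exp g g' g0 s n :
  linearises g g' g0 s -> linearises (g ^+ n) (g' ^+ n) (g0 ^+ n) (lin_exp s n).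
Proof.
move=> gs; elim: n => [|n IHn]; first exact: linearises_one.
by rewrite !expgS; exact: linearises_mul.
Qed.

Lemma linearises_comm g g' g0 s h h' h0 t :
  linearises g g' g0 s -> linearises h h' h0 t ->
  linearises [~ g, h] [~ g', h'] [~ g0, h0] (lin_comm s t).
Proof.
move=> gs ht; apply: linearises_mul; first exact: linearises_inv.
by apply: linearises_mul; [exact: linearises_inv|exact: linearises_mul].
Qed.

Lemma linearises_add g g' g0 s h h' h0 t :
  linearises g g' g0 s -> linearises h h' h0 t ->
  linearises (lie_add g h) (lie_add g' h') (lie_add g0 h0) (lin_add s t).
Proof.
move=> gs ht; have c := linearises_comm gs ht.
apply: linearises_mul; last exact/linearises_exp/linearises_comm.
apply: linearises_mul; last exact/linearises_exp/linearises_comm.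
apply: linearises_mul; last exact/linearises_exp.
exact: linearises_mul.
Qed.

(** An Engel word is trivial at m and at m^-1, so l q = l^-1 q = 1 and l^2 = 1. *)
Lemma linearises_engel g g' g0 s h h' h0 t :
  linearises g g' g0 s -> linearises h h' h0 t ->
  act (lin_part (lin_engel s t)) m = 0%R.
Proof.
move=> gs ht.
have := linearises_comm (linearises_comm (linearises_comm gs ht) ht) ht.
rewrite !engel => -[[q _ []] + + _ _].
set l : M := act _ _; rewrite !mulg1 => e1 e2.
have {}e1 : 1 = l * q by apply: val_inj; rewrite val_nclosureM val_nclosure1.
have {}e2 : 1 = l^-1 * q.
  by apply: val_inj; rewrite val_nclosureM val_nclosureV val_nclosure1.
apply: (sqrg_eq1 nclosure_group_exp5); rewrite -/l expg2.
by rewrite -(mulg1 (l * l)) e2 -mulgA mulVKg -e1.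
Qed.

(** The common linear part l cancels around central factors, leaving q r^-1 on both sides. *)
Lemma linearises_even g g' h h' w s t :
  linearises g g' w s -> linearises h h' w t ->
  act (lin_part s) m = act (lin_part t) m -> g * h^-1 = g' * h'^-1.
Proof.
case=> [[q qc [-> ->]] _ _] [[r rc [-> ->]] _ _] <-; set l : M := act _ _.
have comm (a b : M) : commute a b -> commute (val a) (val b).
  by rewrite /commute -!val_nclosureM => ->.
have := comm _ _ (rc l); have := comm _ _ (qc l).
move: (val l) (val q) (val r) => u a b ua ub.
have c : commute u (a * b^-1).
  by apply: commuteM; [|apply: commuteV]; exact: commute_sym.
transitivity (a * b^-1); group_simpl; first by rewrite -(mulgA u) c mulgK.
by rewrite -(mulgA u^-1) -(mulgA u^-1 (a * b^-1)) -c mulKg.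
Qed.

End TwoOperators.

(** * Linearised Engel relations *)

Section Relations.
Variables x y : G.
Local Notation act := (poly2_act (diffV x) (diffV y)).

(** Linear parts in n of [y, xn, xn, xn], [x, yn, yn, yn] and [n, xy, xy, xy]. *)
Definition engel_relation k : poly2 :=
  match k with
  | 0 => lin_part (lin_engel lin_y (lin_mul lin_x lin_n))
  | 1 => lin_part (lin_engel lin_x (lin_mul lin_y lin_n))
  | _ => lin_part (lin_engel lin_n (lin_mul lin_x lin_y))
  end.

(* The quadruple (c, u, k, v) stands for c u R_k v, with R_k the k-th relation. *)
Definition engel_combination (ts : seq (nat * seq bool * nat * seq bool)) : poly2 :=
  flatten [seq let: (c, u, k, v) := t in
    poly2_mul [:: (c, u)] (poly2_mul (engel_relation k) [:: (1%N, v)]) | t <- ts].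

(** Each relation kills every element of V, so it may be multiplied by words on both sides. *)
Lemma engel_combination_act ts u : act (engel_combination ts) u = 0%R.
Proof.
have rel k v : act (engel_relation k) v = 0%R.
  have lx := linearises_x x y v; have ly := linearises_y x y v.
  have ln := linearises_n x y v.
  case: k => [|[|k]]; last exact: linearises_engel ln (linearises_mul lx ly).
    exact: linearises_engel ly (linearises_mul lx ln).
  exact: linearises_engel lx (linearises_mul ly ln).
have actM := poly2_act_mul (diffVD x) (diffVD y) mulr5V (@word_act_dead_diffV x y).
elim: ts => [|[[[c s] k] t] ts IHts]; first exact: poly2_act_nil.
rewrite /engel_combination /= poly2_act_cat -/(engel_combination ts) IHts addr0.
by rewrite !actM rel (poly2_act0 (diffVD x) (diffVD y)).
Qed.

Lemma linearises_even_comb m g g' h h' w s t ts :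
  linearises x y m g g' w s -> linearises x y m h h' w t ->
  poly2_null (lin_part s ++ poly2_scale 4 (lin_part t) ++ engel_combination ts) ->
  g * h^-1 = g' * h'^-1.
Proof.
move=> gs ht /(poly2_act_null mulr5V (@word_act_dead_diffV x y) m).
rewrite !poly2_act_cat engel_combination_act addr0 poly2_act_scale mulr4V.
by move/eqP; rewrite subr_eq0 => /eqP; exact: linearises_even gs ht.
Qed.

End Relations.

End Linear.

(** * Associativity of the Lie sum *)

Section Associativity.
Variables (G : groupType) (engel : engel3_group G) (exp5 : exponent5_group G).
Implicit Types x y z : G.

Definition lie_defect x y z : G :=
  lie_add (lie_add x y) z * (lie_add x (lie_add y z))^-1.

Lemma lie_add1 x : lie_add x 1 = x.
Proof. by rewrite lie_add_commute ?mulg1 //; exact: commute1. Qed.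

Lemma lie_1add x : lie_add 1 x = x.
Proof. by rewrite lie_addC // lie_add1. Qed.

(* The coefficients come from solving a linear system over F_5. *)
Lemma lie_defectV3 x y z : lie_defect x y z^-1 = lie_defect x y z.
Proof.
pose m : nclosure_module engel exp5 z := nclosure_elt (nclosure_id z).
have lx := linearises_x x y m; have ly := linearises_y x y m.
have := linearises_n x y m; rewrite val_nclosure_elt => ln.
have lA := linearises_add (linearises_add lx ly) ln.
have lB := linearises_add lx (linearises_add ly ln).
(* At n = 1 both bracketings become x + y, the common value w that [linearises_even_comb]
   requires. *)
rewrite !lie_add1 in lA lB.
apply/esym/(linearises_even_comb (ts := [::
  (2, [::], 0, [:: false]); (2, [:: false], 0, [::]); (1, [::], 1, [::]);
  (4, [::], 2, [::]); (1, [:: true], 1, [::]); (4, [::], 1, [:: true]);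
  (3, [::], 2, [:: true])]%N) lA lB).
by vm_compute.
Qed.

(** The same method in N_y, with x and z as operators and the solution of the corresponding linear
    system. *)
Lemma lie_defectV2 x y z : lie_defect x y^-1 z = lie_defect x y z.
Proof.
pose m : nclosure_module engel exp5 y := nclosure_elt (nclosure_id y).
have lx := linearises_x x z m; have lz := linearises_y x z m.
have := linearises_n x z m; rewrite val_nclosure_elt => ly.
have lA := linearises_add (linearises_add lx ly) lz.
have lB := linearises_add lx (linearises_add ly lz).
rewrite lie_add1 lie_1add in lA lB.
apply/esym/(linearises_even_comb (ts := [::
  (4, [::], 0, [::]); (3, [::], 0, [:: false]); (3, [:: false], 0, [::]);
  (1, [::], 1, [::]); (2, [:: true], 1, [::]); (4, [::], 1, [:: true]);
  (4, [::], 2, [:: true])]%N) lA lB).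
by vm_compute.
Qed.

(** Commutativity of + exchanges the two bracketings; this carries invariance in z over to x. *)
Lemma lie_defect_rev x y z : lie_defect z y x = (lie_defect x y z)^-1.
Proof.
rewrite /lie_defect invgF (lie_addC engel exp5 (lie_add z y)).
rewrite (lie_addC engel exp5 z y).
by rewrite (lie_addC engel exp5 z) (lie_addC engel exp5 y x).
Qed.

Lemma lie_defectV1 x y z : lie_defect x^-1 y z = lie_defect x y z.
Proof. by apply: invg_inj; rewrite -!lie_defect_rev lie_defectV3. Qed.

Theorem lie_addA : associative (@lie_add G).
Proof.
move=> x y z; set A := lie_add (lie_add x y) z; set B := lie_add x _.
have e : A * B^-1 = A^-1 * B.
  rewrite -[LHS]/(lie_defect x y z) -lie_defectV1 -lie_defectV2 -lie_defectV3.
  by rewrite /lie_defect -!lie_addV // invgK.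
(* Conjugation by B inverts D = A B^-1, so B^2, and then B, centralises D; hence D = D^-1 and D =
   1. *)
have DB : (A * B^-1)^-1 ^ B = A * B^-1.
  by rewrite [RHS]e invgF conjgE mulgA mulKg.
clearbody A B; move: (A * B^-1) {e} DB (@divg1_eq _ A B) => D DB D1.
have BD : D ^ B = D^-1 by rewrite -[D in LHS]invgK conjVg DB.
have cDB : commute D B.
  by apply/(commute_sqr exp5)/conj_commute; rewrite expg2 conjgM BD.
by apply/esym/D1/(sqrg_eq1 exp5); rewrite expg2 -{1}(commute_conj cDB) BD mulVg.
Qed.

End Associativity.

(** * The Lie algebra *)

Definition lie_carrier (G : groupType) (engel : engel3_group G)
  (exp5 : exponent5_group G) : Type := G.

Section LieCarrier.
Local Open Scope ring_scope.
Variables (G : groupType) (engel : engel3_group G) (exp5 : exponent5_group G).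
Local Notation L := (lie_carrier engel exp5).

Lemma lie_addN : left_inverse 1%g (fun x : G => x^-1%g) (@lie_add G).
Proof.
by move=> x; rewrite lie_add_commute ?mulVg //; exact/commute_sym/commuteV.
Qed.

HB.instance Definition _ := Choice.on L.
HB.instance Definition _ := GRing.isZmodule.Build L (lie_addA engel exp5)
  (lie_addC engel exp5) (@lie_1add G engel exp5) lie_addN.

Lemma lie_mulrn (x : L) n : x *+ n = ((x : G) ^+ n)%g :> G.
Proof.
elim: n => // n IHn; rewrite mulrS expgS.
transitivity (lie_add (x : G) (x *+ n : G)) => //.
by rewrite IHn lie_add_commute //; exact/commuteX.
Qed.

Lemma lie_mulr5 (x : L) : x *+ 5 = 0. Proof. by rewrite lie_mulrn exp5. Qed.

Lemma lie_mulr_mod5 (x : L) n : x *+ n = x *+ (n %% 5).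
Proof. by rewrite {1}(divn_eq n 5) mulrnDr mulnC mulrnA lie_mulr5 mul0rn add0r. Qed.

Definition lie_scale (a : 'F_5) (x : L) : L := x *+ a.

Lemma lie_scaleE n (x : L) : lie_scale n%:R x = x *+ n.
Proof. by rewrite /lie_scale val_Fp_nat // -lie_mulr_mod5. Qed.

Let natF (a : 'F_5) : a = (a : nat)%:R. Proof. by rewrite natr_Zp. Qed.

Lemma lie_scaleA a b x : lie_scale a (lie_scale b x) = lie_scale (a * b) x.
Proof. by rewrite [a]natF [b]natF -natrM !lie_scaleE mulnC mulrnA. Qed.

Lemma lie_scale1 : left_id 1 lie_scale.
Proof. by move=> x; rewrite -[1]/(1%:R) lie_scaleE. Qed.

Lemma lie_scaleDr : right_distributive lie_scale +%R.
Proof. by move=> a x y; rewrite /lie_scale mulrnDl. Qed.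

Lemma lie_scaleDl x : {morph lie_scale^~ x : a b / a + b}.
Proof. by move=> a b; rewrite [a]natF [b]natF -natrD !lie_scaleE mulrnDr. Qed.

HB.instance Definition _ := GRing.Zmodule_isLmodule.Build 'F_5 L
  lie_scaleA lie_scale1 lie_scaleDr lie_scaleDl.

Definition bracket (x y : L) : L := lie_bracket (x : G) (y : G).
Definition lie_conj (g : G) (x : L) : L := ((x : G) ^ g)%g.

Lemma lie_conjD g : {morph lie_conj g : x y / x + y}.
Proof. by move=> x y; exact: (lie_addJ (x : G) (y : G) g). Qed.

Lemma bracketC x y : bracket x y = - bracket y x.
Proof. exact: lie_bracketC. Qed.

Lemma lie_conjE (x y : L) k : (k < 5)%N ->
  lie_conj ((y : G) ^+ k)%g x =
  x + bracket x y *+ k + bracket (bracket x y) y *+ (3 * k ^ 2).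
Proof. by move=> k5; rewrite /lie_conj conj_lie_add // -!lie_mulrn. Qed.

(** Weights 1, 2, 2 at k = 0, 1, 2 isolate the coefficient of k: x occurs 5 times, d 6 times and e
    30 times. The multiples 3 and 12 of e are 3 k^2. *)
Lemma first_coefficient (x d e : L) :
  (x + d *+ 1 + e *+ 3) *+ 2 + (x + d *+ 2 + e *+ 12) *+ 2 + x = d.
Proof.
rewrite -mulrnDl addrACA (addrACA x) -(mulrnDr _ 1) -(mulrnDr _ 3).
rewrite [e *+ _]lie_mulr_mod5 addr0 (mulrnDl 2 (x + x)) -!mulr2n -!mulrnA.
by rewrite addrAC -mulrSr lie_mulr5 add0r lie_mulr_mod5.
Qed.

(* By lie_conjE the bracket is the coefficient of k in the polynomial x^(y^k),
   extracted here from its values at k = 1 and k = 2. *)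
Lemma bracketE (x y : L) :
  bracket x y = lie_conj y x *+ 2 + lie_conj ((y : G) ^+ 2)%g x *+ 2 + x.
Proof.
have e1 : lie_conj y x = x + bracket x y *+ 1 + bracket (bracket x y) y *+ 3.
  by have := @lie_conjE x y 1 isT; rewrite expg1.
by rewrite e1 lie_conjE // first_coefficient.
Qed.

(** [bracketE] writes the bracket as a combination of conjugates of its first argument, each
    additive in it. *)
Lemma bracketDl (y : L) : {morph bracket^~ y : u v / u + v}.
Proof.
move=> u v; rewrite !bracketE !lie_conjD; move: ((y : G) ^+ 2)%g => g.
move: (lie_conj y u) (lie_conj y v) (lie_conj g u) (lie_conj g v) => p q r s.
rewrite (mulrnDl 2 p q) (mulrnDl 2 r s); move: (p *+ 2) (q *+ 2) (r *+ 2) (s *+ 2).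
by move=> {}p {}q {}r {}s; rewrite (addrACA p) (addrACA (p + r)).
Qed.

Lemma bracketDr (y : L) : {morph bracket y : u v / u + v}.
Proof.
by move=> u v; rewrite bracketC bracketDl opprD -!(bracketC y).
Qed.

Lemma bracket0l (y : L) : bracket 0 y = 0.
Proof.
by have /esym/eqP := bracketDl y 0 0; rewrite addr0 -subr_eq0 addrK => /eqP.
Qed.

Lemma bracketNl (x y : L) : bracket (- x) y = - bracket x y.
Proof. by apply/eqP; rewrite -addr_eq0 -bracketDl addNr bracket0l. Qed.

Lemma bracketMnl (x y : L) n : bracket (x *+ n) y = bracket x y *+ n.
Proof.
by elim: n => [|n IHn]; rewrite ?bracket0l // !mulrS bracketDl IHn.
Qed.

Lemma bracketMnr (x y : L) n : bracket x (y *+ n) = bracket x y *+ n.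
Proof. by rewrite bracketC bracketMnl -mulNrn -bracketC. Qed.

Lemma bracketJ g : {morph lie_conj g : x y / bracket x y}.
Proof. by move=> x y; exact: (lie_bracketJ (x : G) (y : G) g). Qed.

(** For n > 0 the sum of k^n over F_5 is -1 if 4 divides n and 0 otherwise, so the weight k^3 picks
    out the coefficient of k, times 4. *)
Lemma power_sum e (u : L) : (e < 5)%N ->
  \sum_(k < 5) u *+ k ^ e *+ k ^ 3 = u *+ (4 * (e == 1%N)).
Proof.
move=> e5; rewrite (eq_bigr (fun k : 'I_5 => u *+ (k ^ e * k ^ 3))); last first.
  by move=> k _; rewrite -mulrnA.
rewrite sumrMnr [LHS]lie_mulr_mod5; congr (_ *+ _).
by case: e e5 => [|[|[|[|[|e]]]]] // _; rewrite !big_ord_recr big_ord0.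
Qed.

(* Conjugation by z^k is exp (k ad z) and preserves the bracket; the coefficient
   of k, extracted by power_sum, says that ad z is a derivation. *)
Lemma bracket_leibniz (x y z : L) :
  bracket (bracket x y) z = bracket (bracket x z) y + bracket x (bracket y z).
Proof.
(* c i is 1/i! modulo 5. *)
pose c i := nth 0%N [:: 1; 1; 3]%N i.
pose ad u i : L := iter i (bracket^~ z) u.
have conjE (u : L) k : (k < 5)%N ->
    lie_conj ((z : G) ^+ k)%g u = \sum_(i < 3) ad u i *+ c i *+ k ^ i.
  move=> k5; rewrite lie_conjE // !big_ord_recl big_ord0 addr0 addrA /c /ad /=.
  by rewrite (mulrnA _ 3).
have bracket_sum (f g : 'I_3 -> L) :
    bracket (\sum_i f i) (\sum_j g j) = \sum_i \sum_j bracket (f i) (g j).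
  have b0r v : bracket v 0 = 0 by rewrite bracketC bracket0l oppr0.
  rewrite (big_morph (bracket^~ _) (bracketDl _) (bracket0l _)).
  apply: eq_bigr => i _.
  by rewrite (big_morph (bracket _) (bracketDr _) (b0r _)).
have bracketMn (u v : L) a b : bracket (u *+ a) (v *+ b) = bracket u v *+ (a * b).
  by rewrite bracketMnl bracketMnr -mulrnA mulnC.
have lhs : \sum_(k < 5) lie_conj ((z : G) ^+ k)%g (bracket x y) *+ k ^ 3 =
    bracket (bracket x y) z *+ 4.
  under eq_bigr => k _ do rewrite conjE // -sumrMnl.
  rewrite exchange_big /=.
  under eq_bigr => i _ do rewrite power_sum ?(leq_trans (ltn_ord i)) //.
  rewrite !big_ord_recl big_ord0 /c /ad /=.
  by rewrite !muln0 !mulr0n !addr0 add0r.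
have rhs : \sum_(k < 5) lie_conj ((z : G) ^+ k)%g (bracket x y) *+ k ^ 3 =
    (bracket (bracket x z) y + bracket x (bracket y z)) *+ 4.
  under eq_bigr => k _.
    rewrite bracketJ !conjE // bracket_sum -sumrMnl.
    under eq_bigr => i _.
      rewrite -sumrMnl.
      under eq_bigr => j _ do rewrite bracketMn -expnD.
      over.
    over.
  rewrite exchange_big.
  under eq_bigr => i _.
    rewrite exchange_big.
    under eq_bigr => j _.
      (* The exponent i + j is at most 4, and only i + j = 1 contributes. *)
      rewrite power_sum; last by case: i j => [[|[|[|i]]] hi] [[|[|[|j]]] hj].
    over.
  over.
  rewrite !big_ord_recl !big_ord0 /= /c /ad /=.
  by rewrite !muln0 !mulr0n !addr0 !add0r !muln1 mulrnDl addrC.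
(* The common factor 4 is its own inverse modulo 5. *)
have mulr16 (u : L) : u *+ 4 *+ 4 = u by rewrite -mulrnA lie_mulr_mod5.
by rewrite -[LHS]mulr16 -lhs rhs mulr16.
Qed.

Lemma bracketDZl (a : 'F_5) (x y z : L) :
  bracket (a *: x + y) z = a *: bracket x z + bracket y z.
Proof. by rewrite bracketDl; congr (_ + _); exact: bracketMnl. Qed.

Lemma bracketDZr (a : 'F_5) (x y z : L) :
  bracket z (a *: x + y) = a *: bracket z x + bracket z y.
Proof. by rewrite bracketDr; congr (_ + _); exact: bracketMnr. Qed.

Lemma bracketxx (x : L) : bracket x x = 0.
Proof. by rewrite /bracket /lie_bracket commgg !comm1g !expg1n !mulg1. Qed.

Lemma bracket_jacobi (x y z : L) :
  bracket (bracket x y) z + bracket (bracket y z) x + bracket (bracket z x) y = 0.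
Proof.
rewrite bracket_leibniz (bracketC x (bracket y z)) addrNK (bracketC z).
by rewrite bracketNl subrr.
Qed.

HB.instance Definition _ := Lmodule_isLieAlgebra.Build 'F_5 L
  bracketDZl bracketDZr bracketxx bracket_jacobi.

Lemma lie_bch (x y : L) : bch x y = ((x : G) * (y : G))%g.
Proof.
have n2 : 2^-1 = 3%:R :> 'F_5 by apply: val_inj.
have n12 : 12^-1 = 3%:R :> 'F_5 by apply: val_inj.
have n12N : - 12^-1 = 2%:R :> 'F_5 by apply: val_inj.
rewrite /bch -scaleNr n2 n12N n12.
have sc n (u : L) : n%:R *: u = ((u : G) ^+ n)%g.
  by rewrite [LHS]lie_scaleE lie_mulrn.
by rewrite !sc [RHS](mulg_bch engel exp5).
Qed.

End LieCarrier.

Theorem theorem3p7 (G : groupType)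
    (G_engel : engel3_group G) (G_exp5 : exponent5_group G) :
  exists S : lieAlg_on 'F_5 G,
    let L : lieAlgType 'F_5 := lieAlg_of S in
    [/\ (forall x y : L, (x + y)%R = lie_add (x : G) (y : G)),
        (forall x y : L, lie x y = lie_bracket (x : G) (y : G)),
        engel3_lie L,
        is_group_law (@bch L)
      & forall x y : L, bch x y = ((x : G) * (y : G))%g].
Proof.
pose L : lieAlgType 'F_5 := lie_carrier G_engel G_exp5.
exists (LieAlgebra.class L); rewrite /=.
have bchE (x y : L) : bch x y = ((x : G) * (y : G))%g by exact: lie_bch.
split=> //.
- move=> x y; exact: (lie_bracket_engel G_engel G_exp5 (x : G) (y : G)).
- split; first by move=> x y z; rewrite !bchE mulgA.
  exists (1%g : G); first by split=> x; rewrite bchE ?mul1g ?mulg1.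
  by move=> x; exists (x : G)^-1%g; rewrite !bchE mulgV mulVg.
Qed.
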